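(* For every integer $n \geqslant 2$, with $m = \left\lfloor \frac{n-1}{2} \right\rfloor \cdot \left\lfloor \frac{n-2}{2} \right\rfloor$, there exists a chain of pairwise non-isomorphic $n$-vertex trees $T_0, T_1, \ldots, T_m$ such that $T_0 \cong S_n$, $T_m \cong P_n$, and $$T_i \preceq_c T_{i+1} \quad \text{for all } i = 0, 1, \ldots, m-1.$$
   Context: For a simple graph $G$ on $n$ vertices with Laplacian matrix $L(G) = D(G) - A(G)$, the Laplacian coefficients $c_0(G), \ldots, c_n(G)$ are defined by $\det(\lambda I_n - L(G)) = \sum_{k=0}^n (-1)^k c_k(G) \lambda^{n-k}$. For $n$-vertex graphs $G, H$, write $G \preceq_c H$ if $c_k(G) \leqslant c_k(H)$ for all $k = 0, 1, \ldots, n$. $S_n$ and $P_n$ denote the star and the path on $n$ vertices. *)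

(* Defs.v *)
From HB Require Import structures.
From mathcomp Require Import all_boot all_order all_algebra.

Set Implicit Arguments.
Unset Strict Implicit.
Unset Printing Implicit Defensive.

Import Order.TTheory GRing.Theory Num.Theory.
Local Open Scope ring_scope.

Record sgraph (n : nat) := SGraph {
  adj :> rel 'I_n;
  adj_sym : symmetric adj;
  adj_irrefl : irreflexive adj
}.

Section Graphs.
Variable n : nat.
Implicit Types G H : sgraph n.

Definition graph_iso G H : Prop :=
  exists2 f : 'I_n -> 'I_n, bijective f & forall x y, H (f x) (f y) = G x y.

(* By convention the null graph is not connected. *)
Definition connected_graph G : Prop :=
  (0 < n)%N /\ forall x y, connect G x y.

(* A [ucycle] with at most two vertices is empty, or a single edge traversed
   back and forth, hence the bound on the size. *)
Definition acyclic_graph G : Prop :=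
  forall s : seq 'I_n, (2 < size s)%N -> ~ ucycle G s.

Definition is_tree G : Prop := connected_graph G /\ acyclic_graph G.

Definition degree G (x : 'I_n) : nat := #|[set y | G x y]|.

Definition degree_mx G : 'M[int]_n := diag_mx (\row_i (degree G i)%:Z).

Definition adjacency_mx G : 'M[int]_n := \matrix_(i, j) (G i j : nat)%:Z.

Definition laplacian G : 'M[int]_n := degree_mx G - adjacency_mx G.

Definition lap_coef G (k : nat) : int :=
  (-1) ^+ k * (char_poly (laplacian G))`_(n - k).

Lemma lap_coefE G :
  \det ('X%:M - map_mx polyC (laplacian G)) =
  \sum_(k < n.+1) ((-1) ^+ k * lap_coef G k) *: 'X^(n - k).
Proof.
rewrite -[LHS]/(char_poly (laplacian G)).
rewrite -[LHS]coefK size_char_poly poly_def (reindex_inj rev_ord_inj) /=.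
by apply: eq_bigr => k _; rewrite subSS /lap_coef mulrA -exprMn mulrNN mul1r
  expr1n mul1r.
Qed.

Definition lap_le G H : Prop :=
  forall k : nat, (k <= n)%N -> lap_coef G k <= lap_coef H k.

Definition star_rel : rel 'I_n :=
  fun i j => (i != j) && ((i == 0%N :> nat) || (j == 0%N :> nat)).

Lemma star_sym : symmetric star_rel.
Proof. by move=> i j; rewrite /star_rel eq_sym orbC. Qed.

Lemma star_irrefl : irreflexive star_rel.
Proof. by move=> i; rewrite /star_rel eqxx. Qed.

Definition star_graph : sgraph n := SGraph star_sym star_irrefl.

Definition path_rel : rel 'I_n :=
  fun i j => (i.+1 == j :> nat) || (j.+1 == i :> nat).

Lemma path_sym : symmetric path_rel.
Proof. by move=> i j; rewrite /path_rel orbC. Qed.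

Lemma path_irrefl : irreflexive path_rel.
Proof. by move=> i; rewrite /path_rel orbb eqn_leq ltnn. Qed.

Definition path_graph : sgraph n := SGraph path_sym path_irrefl.

End Graphs.

(* Main.v *)
Require Import Defs.
From HB Require Import structures.
From mathcomp Require Import all_boot all_order all_algebra.
From mathcomp Require Import perm ring zify.

Set Implicit Arguments.
Unset Strict Implicit.
Unset Printing Implicit Defensive.

Import Order.TTheory GRing.Theory Num.Theory.

(** All the trees used are caterpillars obtained from brooms. A broom is a vertex
with some leaves and one tail of [l] vertices; put [q + 1] leaves at its head,
so that it has [q + l + 2] vertices, and hang one more leaf at distance [j]
from the head along the tail. With all leaves at the head ([j = 0]) this is a
broom with one more leaf, with [j = l] it is a broom with a tail longer by one.
Moving the leaf outwards should increase every Laplacian coefficient as long as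
it moves away from the bulk of the tree. The precise statement [hang_lt] is
that position [j] dominates position [i < j] as soon as [i + j + q >= l]. So
for every tail length [l] the leaf can occupy, after its initial position [0],
each of the last [minn l q.+1] positions: the first of them dominates position
[0], even where some positions in between are worse, and the others follow one by
one. The case [l = 0] is the star, and the path is reached when a single leaf
is left at the head. The sum over [l] of [minn l q.+1], with [q + l] constant,
is the required length ([sum_minn]).

The coefficients are compared through the polynomial [lap_poly G], the
determinant of [X + L(G)], whose coefficients are the Laplacian coefficients
without signs ([lap_coef_poly]). Together with the same determinant where a
marked vertex is pinned, it is transformed linearly when a pendant vertex is
attached at the marked vertex: by the matrix [move] if the new vertex becomes
the marked one, by [stay] otherwise. Hence the polynomial of each tree above is
a coordinate of a product of such matrices applied to a vector. In the
difference between the positions [i] and [j], the commutator of [stay] with a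
power of [move] is a multiple of a single matrix [flip] ([hang_sub]), and the
relation [move * flip * move = flip] lets the two outer powers of [move]
cancel. What remains is a product of polynomials with nonnegative coefficients
and one explicit factor, treated in [tail_gap].

Each step has a difference with nonnegative coefficients and positive value at
1, so that the values at 1 of the polynomials strictly increase along the
chain. As isomorphic graphs have the same polynomial ([lap_poly_iso]), no two
trees of the chain are isomorphic. *)

(** * Determinants with a pendant row and column *)

Section PendantMatrix.
Local Open Scope ring_scope.
Variables (R : comNzRingType) (n : nat).
Implicit Types (A : 'M[R]_n) (x : 'I_n) (d : R).

(** Replacing the row of [x] by a unit vector makes the determinant the principal
cofactor at [x], while keeping matrices of the same size. *)
Definition pin A x : 'M[R]_n :=
  \matrix_(i, j) if i == x then (j == x)%:R else A i j.

(** If [A] is [t + L(G)] then this is, for [d = t + 1], the analogous matrix of the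
graph where a new vertex, indexed first, is joined to [x] only. *)
Definition pendant_mx d A x : 'M[R]_(1 + n) :=
  block_mx d%:M (- delta_mx 0 x) (- delta_mx x 0) (A + delta_mx x x).

Lemma pinE A x : pin A x = A - delta_mx x x *m A + delta_mx x x.
Proof.
apply/matrixP=> i j; rewrite !mxE; case: eqVneq => [->|ne_ix].
  rewrite (bigD1 x) //= big1 => [|k /negPf nk]; rewrite !mxE ?eqxx ?nk ?mul0r //=.
  by rewrite mul1r addr0 subrr add0r.
by rewrite big1 => [|k _]; rewrite ?mxE ?(negPf ne_ix) ?mul0r //= subr0 addr0.
Qed.

Lemma det_add_delta A x : \det (A + delta_mx x x) = \det A + \det (pin A x).
Proof.
rewrite -[\det A]mul1r -[\det (pin A x)]mul1r.
apply: (determinant_multilinear (i0 := x)).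
- by apply/rowP=> j; rewrite !mxE eqxx !mul1r /= [j == x]eq_sym.
- apply/matrixP=> i j; rewrite !mxE [lift _ _ == _]eq_sym.
  by rewrite (negPf (neq_lift _ _)) addr0.
- apply/matrixP=> i j; rewrite !mxE [lift _ _ == _]eq_sym.
  by rewrite (negPf (neq_lift _ _)) addr0.
Qed.

(** The new column clears the row of [x], the new row then puts a unit vector in
it, and that vector in turn clears the new row. *)
Lemma det_link A x :
  \det (block_mx 0 (delta_mx 0 x) (- delta_mx x 0) A : 'M[R]_(1 + n)) =
  \det (pin A x).
Proof.
have e0 : (delta_mx 0 x : 'rV[R]_n) *m pin A x = delta_mx 0 x.
  by rewrite -rowE; apply/rowP=> j; rewrite !mxE !eqxx.
have E : (block_mx 1 (- delta_mx 0 x) 0 1%:M *m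
   (block_mx 1 0 (delta_mx x 0) 1%:M *m
   (block_mx 0 (delta_mx 0 x) (- delta_mx x 0) A *m
    block_mx 1 (row x A) 0 1%:M)) : 'M[R]_(1 + n)) =
  block_mx 1 0 (- delta_mx x 0) (pin A x).
  rewrite !mulmx_block !(mulmx0, mul0mx, mulmx1, mul1mx, add0r, addr0).
  have -> : delta_mx x (0 : 'I_1) *m delta_mx 0 x +
      (- delta_mx x (0 : 'I_1) *m row x A + A) = pin A x.
    rewrite mul_delta_mx rowE mulNmx mulmxA mul_delta_mx.
    by rewrite pinE addrC [- _ + A]addrC.
  have -> : - (delta_mx 0 x : 'rV[R]_n) *m pin A x = - delta_mx 0 x.
    by rewrite mulNmx e0.
  by rewrite subrr mulNmx mulmxN opprK mul_delta_mx; congr block_mx;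
    apply/matrixP=> i j; rewrite !mxE !ord1.
have := congr1 determinant E.
by rewrite !det_mulmx !(det_lblock, det_ublock) !det1 !mul1r mulr1.
Qed.

(** Adding the new column to the column of [x] cancels the added diagonal entry.
The new row becomes a combination of two unit vectors, and the determinant is
linear in that row. *)
Lemma det_pendant d A x :
  \det (pendant_mx d A x) = d * \det A + (d - 1) * \det (pin A x).
Proof.
have E : (pendant_mx d A x *m block_mx 1 (delta_mx 0 x) 0 1%:M : 'M[R]_(1 + n)) =
    block_mx d%:M ((d - 1) *: delta_mx 0 x) (- delta_mx x 0) A.
  rewrite mulmx_block !(mulmx0, mul0mx, mulmx1, mul1mx, add0r, addr0).
  rewrite mul_scalar_mx mulNmx mul_delta_mx scalerBl scale1r.
  by rewrite [A + _]addrC addKr.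
have := congr1 determinant E.
rewrite det_mulmx det_ublock !det1 !mulr1 => ->.
have -> : \det A = \det (block_mx 1 0 (- delta_mx x 0) A : 'M[R]_(1 + n)).
  by rewrite det_lblock det1 mul1r.
rewrite -(det_link A x).
apply: (determinant_multilinear (i0 := lshift n (0 : 'I_1))).
- rewrite !rowKu -!linearZ -linearD !scale_row_mx add_row_mx.
  by rewrite !scaler0 addr0 add0r scalemx1.
- apply/matrixP=> i j; rewrite !mxE; case: (split_ordP (lift _ _)) => k Ek //.
  by have:= neq_lift (lshift n 0) i; rewrite Ek !ord1 eqxx.
- apply/matrixP=> i j; rewrite !mxE; case: (split_ordP (lift _ _)) => k Ek //.
  by have:= neq_lift (lshift n 0) i; rewrite Ek !ord1 eqxx.
Qed.


End PendantMatrix.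

Section PendantPin.
Local Open Scope ring_scope.
Variables (R : comNzRingType) (n : nat).
Implicit Types (A : 'M[R]_n) (x : 'I_n) (d : R).

Lemma det_pin_new d A x :
  \det (pin (pendant_mx d A x) (lshift n ord0)) = \det A + \det (pin A x).
Proof.
rewrite -det_add_delta.
have -> : pin (pendant_mx d A x) (lshift n ord0) =
    block_mx 1 0 (- delta_mx x 0) (A + delta_mx x x).
  apply/matrixP=> i j.
  case: (split_ordP i) => k ->; case: (split_ordP j) => l ->;
    rewrite mxE ?(block_mxEul, block_mxEur, block_mxEdl, block_mxEdr)
      ?(eq_lshift, eq_rshift, eq_lrshift, eq_rlshift) // !ord1 ?eqxx // !mxE //.
by rewrite det_lblock det1 mul1r.
Qed.

Lemma det_pin_old d A x :
  \det (pin (pendant_mx d A x) (rshift 1 x)) = d * \det (pin A x).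
Proof.
have -> : pin (pendant_mx d A x) (rshift 1 x) =
    block_mx d%:M (- delta_mx 0 x) 0 (pin A x).
  apply/matrixP=> i j.
  case: (split_ordP i) => k ->; case: (split_ordP j) => l ->;
    rewrite mxE ?(block_mxEul, block_mxEur, block_mxEdl, block_mxEdr)
       ?(eq_lshift, eq_rshift, eq_lrshift, eq_rlshift) // !mxE.
  - by case: eqP => //=; rewrite oppr0.
  - by case: eqP => //=; rewrite addr0.
by rewrite det_ublock det_scalar1.
Qed.

End PendantPin.

(** * The Laplacian polynomial *)

Section LaplacianPolynomial.
Local Open Scope ring_scope.
Variable n : nat.
Implicit Types (G H : sgraph n) (x : 'I_n).

Lemma degree_sum G x : degree G x = (\sum_y G x y)%N.
Proof.
rewrite /degree -sum1_card big_mkcond; apply: eq_bigr => y _.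
by rewrite inE; case: (G x y).
Qed.

Definition lap_mx G : 'M[{poly int}]_n := 'X%:M + map_mx polyC (laplacian G).

(** Up to signs this is the characteristic polynomial at [- X]. *)
Definition lap_poly G := \det (lap_mx G).

Definition pin_poly G x := \det (pin (lap_mx G) x).

Lemma lap_mxE G i j : lap_mx G i j =
  ('X + (degree G i)%:R) *+ (i == j) - (G i j)%:R.
Proof.
have C (d : nat) : (d%:Z)%:P = d%:R :> {poly int} by rewrite -polyC_natr natz.
by rewrite !mxE rmorphB /= rmorphMn /= !C addrA mulrnDl.
Qed.

Lemma coef_compNX (p : {poly int}) i : (p \Po (- 'X))`_i = (-1) ^+ i * p`_i.
Proof.
have E j : ((- 'X : {poly int}) ^+ j)`_i = (-1) ^+ j * (i == j)%:R.
  have -> : - 'X = (-1)%:P * 'X :> {poly int} by rewrite polyCN mulN1r.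
  by rewrite exprMn -polyC_exp coefCM coefXn.
rewrite coef_comp_poly; under eq_bigr do rewrite E.
have [le_i|lt_i] := leqP (size p) i.
  rewrite nth_default // mulr0 big1 // => j _.
  by rewrite gtn_eqF ?mulr0 // (leq_trans _ le_i).
rewrite (bigD1 (Ordinal lt_i)) //= big1 => [|j /negPf ne_j].
  by rewrite addr0 eqxx mulr1 mulrC.
by rewrite eq_sym [_ == _]ne_j !mulr0.
Qed.

Lemma lap_coef_poly G k : (k <= n)%N -> lap_coef G k = (lap_poly G)`_(n - k).
Proof.
move=> le_kn; have E : char_poly (laplacian G) \Po (- 'X) = (-1) ^+ n * lap_poly G.
  rewrite /char_poly -[LHS]/(comp_poly (- 'X) _) -det_map_mx -detZ; congr determinant.
  apply/matrixP=> i j; rewrite !mxE /= rmorphB rmorphMn /= comp_polyX comp_polyC.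
  by rewrite mulN1r opprD mulNrn.
have := congr1 (fun p : {poly int} => p`_(n - k)) E.
have -> : (-1) ^+ n = ((-1) ^+ n)%:P :> {poly int} by rewrite polyC_exp polyCN.
rewrite coef_compNX coefCM => /(congr1 ( *%R ((-1) ^+ n))).
by rewrite signrMK -{1}(subnKC le_kn) exprD -mulrA signrMK.
Qed.

Lemma lap_poly_iso G H : graph_iso G H -> lap_poly G = lap_poly H.
Proof.
case=> f f_bij fP; pose s := perm (bij_inj f_bij).
have degf x : degree H (f x) = degree G x.
  rewrite !degree_sum (reindex f) /=; last exact: onW_bij.
  by apply: eq_bigr => y _; rewrite fP.
suff : lap_mx G = row_perm s (col_perm s (lap_mx H)).
  rewrite /lap_poly => ->.
  rewrite row_permE col_permE !det_mulmx !det_perm odd_permV.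
  by rewrite mulrCA -expr2 sqrr_sign mulr1.
apply/matrixP=> i j; rewrite 2![in RHS]mxE !lap_mxE !permE degf fP.
by rewrite (inj_eq (bij_inj f_bij)).
Qed.

End LaplacianPolynomial.

(** * Attaching a pendant vertex to a graph *)

Section PendantGraph.
Variable n : nat.
Implicit Types (G : sgraph n) (x : 'I_n).

(** The new vertex is [ord0] and the old vertices are shifted by [lift ord0]. *)
Definition pendant_rel G x : rel 'I_n.+1 := fun i j =>
  match unlift ord0 i, unlift ord0 j with
  | Some i', Some j' => G i' j'
  | Some i', None => i' == x
  | None, Some j' => j' == x
  | None, None => false
  end.

Lemma pendant_sym G x : symmetric (pendant_rel G x).
Proof.
move=> i j; rewrite /pendant_rel.
by case: unliftP => [i'|] _; case: unliftP => [j'|] _ //; apply: adj_sym.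
Qed.

Lemma pendant_irrefl G x : irreflexive (pendant_rel G x).
Proof.
by move=> i; rewrite /pendant_rel; case: unliftP => [i'|] _ //; apply: adj_irrefl.
Qed.

Definition pendant_graph G x : sgraph n.+1 :=
  SGraph (pendant_sym G x) (pendant_irrefl G x).

Lemma pendant_old G x i j : pendant_graph G x (lift ord0 i) (lift ord0 j) = G i j.
Proof. by rewrite /= /pendant_rel !liftK. Qed.

Lemma pendant_newl G x j : pendant_graph G x ord0 (lift ord0 j) = (j == x).
Proof. by rewrite /= /pendant_rel liftK unlift_none. Qed.

Lemma pendant_newr G x i : pendant_graph G x (lift ord0 i) ord0 = (i == x).
Proof. by rewrite /= /pendant_rel liftK unlift_none. Qed.

End PendantGraph.

Section PendantLaplacian.
Local Open Scope ring_scope.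
Variable n : nat.
Implicit Types (G : sgraph n) (x : 'I_n).

Lemma degree_new G x : degree (pendant_graph G x) ord0 = 1%N.
Proof.
rewrite degree_sum big_ord_recl adj_irrefl add0n (bigD1 x) // pendant_newl eqxx.
by rewrite big1 // => y /negPf ne; rewrite pendant_newl ne.
Qed.

Lemma degree_old G x i :
  degree (pendant_graph G x) (lift ord0 i) = (degree G i + (i == x))%N.
Proof.
rewrite !degree_sum big_ord_recl pendant_newr addnC; congr addn.
by apply: eq_bigr => j _; rewrite pendant_old.
Qed.

Lemma lap_mx_pendant G x :
  lap_mx (pendant_graph G x) = pendant_mx ('X + 1) (lap_mx G) x.
Proof.
have l0 : lshift n (ord0 : 'I_1) = ord0 by apply: val_inj.
have rl (i : 'I_n) : rshift 1 i = lift ord0 i by apply: val_inj.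
apply/(@matrixP _ (1 + n) (1 + n)) => i j; rewrite lap_mxE /pendant_mx.
case: (@split_ordP 1 n i) => i' ->; case: (@split_ordP 1 n j) => j' ->;
  rewrite ?(block_mxEul, block_mxEur, block_mxEdl, block_mxEdr) ?ord1 ?l0 ?rl.
- by rewrite degree_new adj_irrefl !mxE !eqxx subr0.
- by rewrite pendant_newl !mxE mulr0n sub0r.
- by rewrite pendant_newr !mxE mulr0n sub0r andbT.
rewrite pendant_old degree_old mxE lap_mxE (inj_eq lift_inj) !mxE.
rewrite addrAC natrD; congr (_ - _); case: (eqVneq i' j') => [<-|ne_ij].
  by rewrite andbb !mulr1n addrA.
rewrite !mulr0n add0r; case: eqVneq => //= Ei.
by rewrite -Ei eq_sym (negPf ne_ij).
Qed.

Lemma lap_poly_pendant G x :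
  lap_poly (pendant_graph G x) = ('X + 1) * lap_poly G + 'X * pin_poly G x.
Proof. by rewrite /lap_poly lap_mx_pendant det_pendant addrK. Qed.

Lemma pin_poly_new G x :
  pin_poly (pendant_graph G x) ord0 = lap_poly G + pin_poly G x.
Proof.
rewrite /pin_poly lap_mx_pendant -(det_pin_new ('X + 1)).
by congr (\det (pin _ _)); apply: val_inj.
Qed.

Lemma pin_poly_old G x :
  pin_poly (pendant_graph G x) (lift ord0 x) = ('X + 1) * pin_poly G x.
Proof.
rewrite /pin_poly lap_mx_pendant -det_pin_old.
by congr (\det (pin _ _)); apply: val_inj.
Qed.

End PendantLaplacian.

(** * Pendant vertices and trees *)

Section PendantTree.
Variable n : nat.
Implicit Types (G : sgraph n) (x : 'I_n).

Lemma pendant_tree G x : is_tree G -> is_tree (pendant_graph G x).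
Proof.
case=> [[_ G_conn] G_acyc]; split.
  split=> // i j; set P := pendant_graph G x.
  have old i' j' : connect P (lift ord0 i') (lift ord0 j').
    have /connectP[p pP ->] := G_conn i' j'.
    apply/connectP; exists (map (lift ord0) p); last by rewrite last_map.
    by rewrite path_map; apply: sub_path pP => a b; rewrite -(pendant_old G x).
  have new : connect P ord0 (lift ord0 x) by apply: connect1; rewrite pendant_newl.
  have new' : connect P (lift ord0 x) ord0 by apply: connect1; rewrite pendant_newr.
  case: (unliftP ord0 i) => [i'|] ->; case: (unliftP ord0 j) => [j'|] -> //.
  - exact: connect_trans (old i' x) new'.
  - exact: connect_trans new (old x j').
(* A cycle through the new vertex would visit its only neighbour twice, and a
   cycle avoiding it is a cycle of the old graph. *)
move=> s s_gt2 s_cycle; have [s0|s0] := boolP (ord0 \in s).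
  have [i t Es] := rot_to s0.
  have: ucycle (pendant_graph G x) (ord0 :: t) by rewrite -Es rot_ucycle.
  move: s_gt2; rewrite -(size_rot i) Es; case: t {Es} => [|y t] //.
  case/lastP: t => [|t z] // _; case/andP=> /andP[Py].
  rewrite -/(path _ _) rcons_path last_rcons => /andP[_ Pz].
  have -> : y = lift ord0 x.
    case: (unliftP ord0 y) Py => [y'|] ->; rewrite ?adj_irrefl //.
    by rewrite pendant_newl => /eqP->.
  have -> : z = lift ord0 x.
    case: (unliftP ord0 z) Pz => [z'|] ->; rewrite ?adj_irrefl //.
    by rewrite pendant_newr => /eqP->.
  by rewrite /= mem_rcons inE eqxx /= andbF.
have [s' Es] : exists s', s = map (lift ord0) s'.
  elim: s {s_gt2 s_cycle} s0 => [|v s IHs]; first by exists [::].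
  rewrite inE negb_or => /andP[v0 /IHs[s' ->]].
  by case: (unliftP ord0 v) v0 => [v'|] -> // _; exists (v' :: s').
apply: (G_acyc s'); first by move: s_gt2; rewrite Es size_map.
move: s_cycle; rewrite Es /ucycle map_inj_uniq; last exact: lift_inj.
case/andP=> s_cyc ->; rewrite andbT; case: s' s_cyc {Es} => //= a t.
rewrite -map_rcons path_map; apply: sub_path => b c /=.
by rewrite -[pendant_rel _ _ _ _]/(pendant_graph G x _ _) pendant_old.
Qed.

End PendantTree.

Lemma single_tree (G : sgraph 1) : is_tree G.
Proof.
split; first by split=> // x y; rewrite [x]ord1 [y]ord1 connect0.
move=> s s_gt2 /andP[_ /card_uniqP s_card].
by have := max_card (mem s); rewrite s_card card_ord leqNgt (ltnW s_gt2).
Qed.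

(** * The transfer matrices *)

Section Transfer.
Local Open Scope ring_scope.
Variables (R : comNzRingType) (t : R).
Implicit Types (v : R * R) (i j k l : nat).

(** A vector [v] stands for the pair of [lap_poly G] and [pin_poly G x], for a
marked vertex [x] of [G]. A pendant vertex is attached at [x] and the mark
stays. *)
Definition stay v : R * R := ((t + 1) * v.1 + t * v.2, (t + 1) * v.2).

(** A pendant vertex is attached at [x] and the mark moves to it. *)
Definition move v : R * R := ((t + 1) * v.1 + t * v.2, v.1 + v.2).

(** The matrix [flip] satisfies [stay * move - move * stay = t *: flip]. *)
Definition flip v : R * R := (v.1 - t * v.2, - v.2).

Definition tail_fst k := (iter k move (1, 0)).1.

Definition tail_snd k := (iter k move (1, 0)).2.

Lemma tail_fstS k : tail_fst k.+1 = (t + 1) * tail_fst k + t * tail_snd k.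
Proof. by []. Qed.

Lemma tail_sndS k : tail_snd k.+1 = tail_fst k + tail_snd k.
Proof. by []. Qed.

(** By the Cayley-Hamilton theorem every power of [move] is a combination of [move]
and the identity, so that its first column determines it. *)
Lemma iter_move k v : iter k move v =
  (tail_fst k * v.1 + t * tail_snd k * v.2,
   tail_snd k * v.1 + (tail_fst k - t * tail_snd k) * v.2).
Proof.
elim: k => [|k /= ->].
  by case: v => x y; rewrite /tail_fst /tail_snd /=; congr (_, _); ring.
by rewrite tail_fstS tail_sndS /move /=; congr (_, _); ring.
Qed.

Lemma flip_move v : move (flip (move v)) = flip v.
Proof. by rewrite /move /flip /=; congr (_, _); ring. Qed.

(** Pairs of [move] on both sides of [flip] cancel until one side is used up; this
lemma and the next one treat the two possible outcomes. *)
Lemma flip_iter_le i s v : (i <= s)%N ->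
  iter s move (flip (iter i move v)) = iter (s - i) move (flip v).
Proof.
elim: i s => [|i IHi] [|s] // le_is.
by rewrite [iter i.+1 _ _]iterS iterSr flip_move IHi ?subSS.
Qed.

Lemma flip_iter_ge i s v : (s <= i)%N ->
  iter s move (flip (iter i move v)) = flip (iter (i - s) move v).
Proof.
elim: s i => [|s IHs] [|i] // le_si.
by rewrite [iter i.+1 _ _]iterS iterSr flip_move IHs ?subSS.
Qed.

(** When [v] describes a graph marked at [x], this is the Laplacian polynomial of
that graph with a tail of [l] vertices attached at [x] and a further leaf on
the vertex of the tail at distance [j] from [x]. *)
Definition hang l j v : R := (iter (l - j) move (stay (iter j move v))).1.

(** Both polynomials share the first [i] and the last [l - j] steps of the tail, so
that the difference involves the commutator of [stay] with the [j - i]-th power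
of [move]. *)
Lemma hang_sub l i j v : (i <= j <= l)%N ->
  hang l j v - hang l i v =
  t * tail_snd (j - i) * (iter (l - j) move (flip (iter i move v))).1.
Proof.
case/andP=> le_ij le_jl; rewrite /hang.
have -> : (l - i = (l - j) + (j - i))%N by lia.
have -> : iter j move v = iter (j - i) move (iter i move v) by rewrite -iterD subnK.
rewrite iterD; set w := iter i move v.
by rewrite !(iter_move (l - j)) !(iter_move (j - i)) /stay /flip /=; ring.
Qed.

End Transfer.

(** * Positivity of the differences *)

Section Positive.
Local Open Scope ring_scope.
Implicit Types p q : {poly int}.

Definition nneg_poly p := forall i, 0 <= p`_i.

Definition pos_poly p := nneg_poly p /\ 0 < p.[1].

Lemma nneg_polyD p q : nneg_poly p -> nneg_poly q -> nneg_poly (p + q).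
Proof. by move=> p0 q0 i; rewrite coefD addr_ge0. Qed.

Lemma nneg_polyM p q : nneg_poly p -> nneg_poly q -> nneg_poly (p * q).
Proof. by move=> p0 q0 i; rewrite coefM sumr_ge0 // => j _; rewrite mulr_ge0. Qed.

Lemma nneg_polyX : nneg_poly 'X.
Proof. by move=> i; rewrite coefX. Qed.

Lemma nneg_poly_nat n : nneg_poly n%:R.
Proof. by move=> i; rewrite coefMn coef1 mulrn_wge0. Qed.


Lemma nneg_horner1 p : nneg_poly p -> 0 <= p.[1].
Proof.
move=> p_ge0; rewrite horner_coef sumr_ge0 // => i _.
by rewrite expr1n mulr1.
Qed.

Lemma pos_polyM p q : pos_poly p -> pos_poly q -> pos_poly (p * q).
Proof.
by case=> [p0 p1] [q0 q1]; split; [apply: nneg_polyM | rewrite hornerM mulr_gt0].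
Qed.

Lemma pos_polyDl p q : pos_poly p -> nneg_poly q -> pos_poly (p + q).
Proof.
by case=> [p0 p1] q0; split; [apply: nneg_polyD | rewrite hornerD ltr_wpDr ?nneg_horner1].
Qed.

Lemma pos_poly1 : pos_poly 1.
Proof. by split; [exact: (nneg_poly_nat 1) | rewrite hornerC]. Qed.

Lemma pos_polyX : pos_poly 'X.
Proof. by split; [apply: nneg_polyX | rewrite hornerX]. Qed.

Lemma pos_polyX1 : pos_poly ('X + 1).
Proof. by apply: pos_polyDl pos_polyX _; apply: (nneg_poly_nat 1). Qed.

Lemma pos_polyXn n p : pos_poly p -> pos_poly (p ^+ n).
Proof.
move=> p_pos; elim: n => [|n IHn]; first exact: pos_poly1.
by rewrite exprS; apply: pos_polyM.
Qed.

Local Notation a := (tail_fst ('X : {poly int})).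
Local Notation u := (tail_snd ('X : {poly int})).

Lemma tail_nneg k :
  nneg_poly (a k) /\ nneg_poly (u k).
Proof.
elim: k => [|k [IHa IHu]]; first by split;
  [apply: (nneg_poly_nat 1) | apply: (nneg_poly_nat 0)].
by rewrite tail_fstS tail_sndS; split;
  do ?[apply: nneg_polyD | apply: nneg_polyM | apply: nneg_polyX
      | apply: (nneg_poly_nat 1)].
Qed.

Lemma tail_fst_pos k : pos_poly (a k).
Proof.
elim: k => [|k IHk]; first exact: pos_poly1.
rewrite tail_fstS; apply: pos_polyDl; first by apply: pos_polyM => //; apply: pos_polyX1.
by apply: nneg_polyM nneg_polyX _; case: (tail_nneg k).
Qed.

Lemma tail_snd_pos k : (0 < k)%N -> pos_poly (u k).
Proof.
case: k => // k _; rewrite tail_sndS; apply: pos_polyDl; first exact: tail_fst_pos.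
by case: (tail_nneg k).
Qed.

(** By induction on [k]: passing from [(k, d)] to [(k + 1, d + 1)] only adds terms
with nonnegative coefficients. *)
Lemma tail_gap k d : (k < d)%N -> pos_poly (d%:R * a k - ('X + 1) * u k).
Proof.
elim: k => [|k IHk] in d *; case: d => // d lt_kd.
  rewrite /tail_snd /tail_fst /= mulr0 subr0 mulr1.
  by split; [apply: nneg_poly_nat | rewrite -polyC_natr hornerC ltr0n].
have [ak uk] := tail_nneg k; rewrite tail_fstS tail_sndS.
have -> : d.+1%:R * (('X + 1) * a k + 'X * u k) - ('X + 1) * (a k + u k) =
  (d%:R * a k - ('X + 1) * u k) + (d%:R * 'X * a k + d.+1%:R * 'X * u k).
  by rewrite -[d.+1]addn1 natrD; ring.
apply: pos_polyDl; first exact: IHk.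
by do ?[apply: nneg_polyD | apply: nneg_polyM | apply: nneg_polyX
       | apply: nneg_poly_nat].
Qed.

(** The pair of polynomials of the star with [n + 1] leaves, marked at its centre. *)
Definition hub n : {poly int} * {poly int} :=
  (('X + 1) ^+ n * 'X * ('X + 1 + n.+1%:R), ('X + 1) ^+ n.+1).

Lemma stay_hub n : stay 'X (hub n) = hub n.+1.
Proof.
have E : n.+2%:R = n.+1%:R + 1 :> {poly int} by rewrite -[n.+2]addn1 natrD.
by rewrite /stay /hub /= E !exprS; congr (_, _); ring.
Qed.

(** The hypothesis says that the tail beyond the leaf at [j] has at most [q + i]
vertices. If it has at least [i] vertices, the difference comes down to the gap
of [tail_gap]; otherwise [flip] acts on a graph whose mark has just been moved,
and gives back the Laplacian polynomial of the previous graph. *)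
Lemma hang_lt (q l i j : nat) : (i < j <= l)%N -> (l <= i + j + q)%N ->
  pos_poly (hang 'X l j (hub q) - hang 'X l i (hub q)).
Proof.
case/andP=> lt_ij le_jl le_lq; rewrite hang_sub ?(ltnW lt_ij) //.
apply: pos_polyM.
  by apply: pos_polyM; [apply: pos_polyX | apply: tail_snd_pos; rewrite subn_gt0].
case: (leqP i (l - j)) => [le_i|lt_i]; last first.
  rewrite flip_iter_ge ?(ltnW lt_i) //.
  rewrite -subn_gt0 in lt_i; case: (i - _)%N lt_i => // s _.
  rewrite iterS /flip /move /=; set w := iter s _ _.
  have -> : ('X + 1) * w.1 + 'X * w.2 - 'X * (w.1 + w.2) = w.1 by ring.
  rewrite /w iter_move /=; have [sa su] := tail_nneg s.
  apply: pos_polyDl.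
    apply: pos_polyM; first exact: tail_fst_pos.
    apply: pos_polyM; last by apply: pos_polyDl pos_polyX1 _; apply: nneg_poly_nat.
    by apply: pos_polyM pos_polyX; apply: pos_polyXn pos_polyX1.
  have [X1n _] := pos_polyXn q.+1 pos_polyX1.
  by do 2![apply: nneg_polyM => //]; apply: nneg_polyX.
rewrite flip_iter_le // iter_move /=; set k := (_ - i)%N.
have lt_kq : (k < q.+1)%N by lia.
have -> : a k * (('X + 1) ^+ q * 'X * ('X + 1 + q.+1%:R) - 'X * ('X + 1) ^+ q.+1) +
    'X * u k * - ('X + 1) ^+ q.+1 =
  ('X + 1) ^+ q * 'X * (q.+1%:R * a k - ('X + 1) * u k) by rewrite exprS; ring.
apply: pos_polyM (tail_gap lt_kq).
by apply: pos_polyM pos_polyX; apply: pos_polyXn pos_polyX1.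
Qed.

End Positive.

Section LaplacianOrder.
Local Open Scope ring_scope.
Variable n : nat.
Implicit Types G H : sgraph n.

Definition lap_lt G H := pos_poly (lap_poly H - lap_poly G).

Lemma lap_lt_le G H : lap_lt G H -> lap_le G H.
Proof.
case=> nneg _ k le_kn; rewrite !lap_coef_poly // -subr_ge0 -coefB.
exact: nneg.
Qed.

Lemma lap_lt_horner G H : lap_lt G H -> (lap_poly G).[1] < (lap_poly H).[1].
Proof. by case=> _; rewrite hornerD hornerN subr_gt0. Qed.

End LaplacianOrder.

(** * Caterpillars grown from words *)

Section Caterpillar.
Implicit Types w : nat -> bool.

(** A caterpillar is grown from a single marked vertex, one pendant vertex at the
marked vertex at a time; the letter [w i] tells whether the mark moves to the
new vertex at step [i]. Reading the word as a function on [nat] gives a graph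
on [n.+1] vertices without casts. *)
Fixpoint grow w n : sgraph n.+1 * 'I_n.+1 :=
  if n is k.+1 then
    let: (G, x) := grow w k in
    (pendant_graph G x, if w k then ord0 else lift ord0 x)
  else (star_graph 1, ord0).

Definition cat_tree w n : sgraph n.+1 := (grow w n).1.

Lemma cat_treeS w n :
  cat_tree w n.+1 = pendant_graph (cat_tree w n) (grow w n).2.
Proof. by rewrite /cat_tree /=; case: (grow w n). Qed.

Lemma grow_endS w n :
  (grow w n.+1).2 = if w n then ord0 else lift ord0 (grow w n).2.
Proof. by rewrite /=; case: (grow w n). Qed.

Lemma cat_tree_is_tree w n : is_tree (cat_tree w n).
Proof.
elim: n => [|n IHn]; first exact: single_tree.
by rewrite cat_treeS; apply: pendant_tree.
Qed.

Definition grow_poly w n :=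
  (lap_poly (cat_tree w n), pin_poly (cat_tree w n) (grow w n).2).

Local Open Scope ring_scope.

Lemma grow_polyS w n :
  grow_poly w n.+1 = (if w n then move 'X else stay 'X) (grow_poly w n).
Proof.
rewrite /grow_poly cat_treeS grow_endS lap_poly_pendant.
by case: (w n); rewrite ?pin_poly_new ?pin_poly_old.
Qed.

Lemma grow_poly0 w : grow_poly w 0 = ('X, 1).
Proof.
have deg0 (G : sgraph 1) x : degree G x = 0%N.
  by rewrite degree_sum big_ord1 [x]ord1 adj_irrefl.
rewrite /grow_poly /lap_poly /pin_poly !det_mx11 lap_mxE deg0 adj_irrefl.
by rewrite subr0 addr0 [(grow _ _).2]ord1 [pin _ _ _ _]mxE !eqxx.
Qed.

Lemma grow_poly_const w m k b :
  (forall i, (m <= i < m + k)%N -> w i = b) ->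
  grow_poly w (m + k) = iter k (if b then move 'X else stay 'X) (grow_poly w m).
Proof.
elim: k => [|k IHk] wb; first by rewrite addn0.
rewrite addnS grow_polyS wb ?leq_addr ?addnS ?leqnn // IHk // => i /andP[le_mi lt_i].
by rewrite wb // le_mi addnS leqW.
Qed.

(** The first letter makes the initial vertex one of the [q.+1] leaves at the head
of the broom. After step [q] the mark moves along the tail, except when the
extra leaf is hung at distance [j] from the head. *)
Definition word q j i :=
  (i == 0)%N || ((q < i)%N && (i != q.+1 + j)%N).

Lemma lap_poly_word N q l j : N = (q + l).+2 -> (j <= l)%N ->
  lap_poly (cat_tree (word q j) N) = hang 'X l j (hub q).
Proof.
move=> -> le_jl; rewrite -[LHS]/(grow_poly (word q j) (q + l).+2).1 /hang.
have -> : (q + l).+2 = ((1 + q + j).+1 + (l - j))%N by lia.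
rewrite (@grow_poly_const _ _ _ true); last by move=> i; rewrite /word; lia.
rewrite grow_polyS ifN; last by rewrite /word; lia.
rewrite (@grow_poly_const _ (1 + q) j true); last by move=> i; rewrite /word; lia.
rewrite (@grow_poly_const _ 1 q false); last by move=> i; rewrite /word; lia.
congr (iter _ _ (stay _ (iter _ _ _))).1.
elim: {N l le_jl} q => [|q IHq] /=; last by rewrite IHq stay_hub.
rewrite grow_polyS grow_poly0 /move /hub /= expr0 expr1.
by congr (_, _); ring.
Qed.

(** The two polynomials belong to the same broom: hanging a leaf at the end of the
tail lengthens the tail. *)
Lemma hang_end q l : hang 'X l.+1 0 (hub q) = hang 'X l l (hub q.+1).
Proof. by rewrite /hang subnn subn0 iterS [iter 0 _ _]/= stay_hub. Qed.

End Caterpillar.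

(** * The star and the path *)

Section Endpoints.
Implicit Types w : nat -> bool.

Lemma cat_tree_star w n : (forall i, i < n -> w i = (i == 0)) ->
  graph_iso (cat_tree w n) (star_graph n.+1).
Proof.
move=> w_star; set c := (grow w n).2.
suff adjE i j : cat_tree w n i j = (i != j) && ((i == c) || (j == c)).
  have cP k : (tperm c ord0 k == 0 :> nat) = (k == c).
    by rewrite -(inj_eq (@perm_inj _ (tperm c ord0)) k c) tpermL.
  exists (tperm c ord0) => [|i j]; first exact: injF_bij perm_inj.
  by rewrite adjE /= /star_rel (inj_eq perm_inj) !cP.
rewrite {}/c; elim: n w_star i j => [|n IHn] w_star i j.
  by rewrite [i]ord1 [j]ord1 eqxx.
rewrite cat_treeS grow_endS w_star //.
have {}IHn := IHn (fun i lt_in => w_star i (leqW lt_in)).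
case: n => [|n] in IHn w_star i j *; rewrite [_ == 0]/=;
  case: (unliftP ord0 i) => [i'|] ->; case: (unliftP ord0 j) => [j'|] ->;
  rewrite ?pendant_newl ?pendant_newr ?pendant_old ?adj_irrefl ?IHn
    ?(inj_eq lift_inj) ?eqxx ?ord1 //.
  by rewrite /= orbF.
Qed.

Lemma pendant_path n (G : sgraph n.+1) : G =2 path_graph n.+1 ->
  pendant_graph G ord0 =2 path_graph n.+2.
Proof.
move=> GP i j; case: (unliftP ord0 i) => [i'|] ->; case: (unliftP ord0 j) => [j'|] ->.
- by rewrite pendant_old GP /= /path_rel !lift0 !eqSS.
- by rewrite pendant_newr /= /path_rel lift0 /= eqSS eq_sym.
- by rewrite pendant_newl /= /path_rel lift0 /= eqSS orbF eq_sym.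
- by rewrite !adj_irrefl.
Qed.

(** The last letter only places the mark; at the end of the chain it is the one
that hangs the extra leaf at the end of the tail. *)
Lemma cat_tree_path w n : (forall i, i.+1 < n -> w i) ->
  graph_iso (cat_tree w n) (path_graph n.+1).
Proof.
move=> w_path; exists id => [|i j]; first by exists id.
suff: cat_tree w n =2 path_graph n.+1 by move->.
case: n => [|n] in w_path {i j} *.
  by move=> i j; rewrite [i]ord1 [j]ord1 !adj_irrefl.
suff [E e0] : cat_tree w n =2 path_graph n.+1 /\ (grow w n).2 = ord0.
  by rewrite cat_treeS e0; apply: pendant_path.
elim: n w_path => [|n IHn] w_path.
  by split=> // i j; rewrite [i]ord1 [j]ord1 !adj_irrefl.
have [E e0] := IHn (fun i lt_in => w_path i (leqW lt_in)).
by rewrite cat_treeS grow_endS w_path // e0; split=> //; apply: pendant_path.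
Qed.

End Endpoints.

(** * The chain *)

Section Chain.
Implicit Types w : nat -> bool.

Definition ascent n k w w' := exists T : nat -> nat -> bool,
  [/\ T 0 = w, T k = w' &
      forall i, i < k -> lap_lt (cat_tree (T i) n) (cat_tree (T i.+1) n)].

(** The end of the first ascent and the start of the second need only have the same
polynomial: the start [w2'] is skipped, which is possible because the second
ascent is not empty. *)
Lemma ascent_cat n k k' w1 w2 w2' w3 : 0 < k' ->
  lap_poly (cat_tree w2 n) = lap_poly (cat_tree w2' n) ->
  ascent n k w1 w2 -> ascent n k' w2' w3 -> ascent n (k + k') w1 w3.
Proof.
move=> k'_gt0 eq_w [T [T0 Tk Tlt]] [T' [T'0 T'k T'lt]].
exists (fun i => if i <= k then T i else T' (i - k)); split=> //.
  by rewrite leqNgt -addn1 leq_add2l k'_gt0 addKn.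
move=> i lt_i; case: (ltngtP i k) => [lt_ik|lt_ki|Ei].
- exact: Tlt.
- by rewrite subSn 1?ltnW //; apply: T'lt; lia.
rewrite Ei subSnn Tk; have := T'lt 0 k'_gt0.
by rewrite /lap_lt eq_w T'0.
Qed.

(** The leaf jumps from the head to position [l - minn l q.+1 + 1], the first
position that [hang_lt] allows, and then advances by one vertex at a time. *)
Lemma ascent_block q l : 0 < l ->
  ascent (q + l).+2 (minn l q.+1) (word q 0) (word q l).
Proof.
move=> l_gt0; set r := minn l q.+1.
exists (fun i => word q (if i == 0 then 0 else l - r + i)); split=> //.
  by rewrite ifN; [congr word | ]; lia.
by move=> [|i] lt_ir; rewrite /lap_lt !(@lap_poly_word _ q l) /=; try lia;
  apply: hang_lt; lia.
Qed.

Lemma ascent_chain K L : L <= K ->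
  ascent K.+2 (\sum_(l < L) minn l.+1 (K - l)) (word K 0) (word (K - L) L).
Proof.
elim: L => [|L IHL] le_LK.
  by rewrite big_ord0 subn0; exists (fun=> word K 0).
rewrite big_ord_recr /=.
have EK : (K - L.+1 + L.+1).+2 = K.+2 by lia.
have KL : K - L = (K - L.+1).+1 by lia.
have := ascent_block (K - L.+1) (ltn0Sn L); rewrite EK -KL.
apply: ascent_cat (IHL (ltnW le_LK)); first lia.
rewrite KL (@lap_poly_word _ _ L) ?(@lap_poly_word _ _ L.+1) ?hang_end //; lia.
Qed.

(** Going from [K] to [K + 2] adds 1 to each of the [K] terms and a new term 1 at
either end. *)
Lemma sum_minn K : \sum_(l < K) minn l.+1 (K - l) = (K.+2 %/ 2) * (K.+1 %/ 2).
Proof.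
have [h] := ubnP K; elim: h K => // h IHh [|[|K]] lt_K.
- by rewrite big_ord0.
- by rewrite big_ord1.
rewrite big_ord_recl big_ord_recr /= /bump /=.
rewrite (eq_bigr (fun l : 'I_K => 1 + minn l.+1 (K - l))); last first.
  by move=> l _; have := ltn_ord l; lia.
rewrite big_split /= sum1_card card_ord IHh; last lia.
have [E1 E2] : K.+4 %/ 2 = (K.+2 %/ 2).+1 /\ K.+3 %/ 2 = (K.+1 %/ 2).+1 by lia.
have E3 : K.+2 %/ 2 + K.+1 %/ 2 = K.+1 by lia.
by rewrite E1 E2 mulSn mulnS; lia.
Qed.

End Chain.

Theorem mainTheorem6 (n : nat) (m : nat) (hn : 2 <= n)
    (hm : m = ((n - 1) %/ 2) * ((n - 2) %/ 2)) :
  exists T : nat -> sgraph n,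
    (forall i, i <= m -> is_tree (T i)) /\
    (forall i j, i <= m -> j <= m -> i <> j -> ~ graph_iso (T i) (T j)) /\
    graph_iso (T 0) (star_graph n) /\
    graph_iso (T m) (path_graph n) /\
    (forall i, i < m -> lap_le (T i) (T i.+1)).
Proof.
case: n => [|[|[|K]]] in hn hm *; try by [].
  (* On two vertices the star is the path. *)
  rewrite {}hm; exists (fun=> cat_tree (pred1 0) 1).
  split=> [i _|]; first exact: cat_tree_is_tree.
  split=> [[|i] [|j] //|].
  by split; first exact: cat_tree_star; split=> //; apply: cat_tree_path.
have := ascent_chain (leqnn K); rewrite subnn sum_minn.
have <- : m = (K.+2 %/ 2) * (K.+1 %/ 2) by rewrite hm !subSS !subn0.
case=> T [T0 Tm Tlt]; exists (fun i => cat_tree (T i) K.+2).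
have mono i j : i < j <= m ->
    ((lap_poly (cat_tree (T i) K.+2)).[1] < (lap_poly (cat_tree (T j) K.+2)).[1])%R.
  case/andP=> lt_ij; elim: j => // j IHj in lt_ij * => le_jm.
  have := lap_lt_horner (Tlt j le_jm).
  move: lt_ij; rewrite ltnS leq_eqVlt => /predU1P[-> //|lt_ij].
  by apply: lt_trans; apply: IHj => //; apply: ltnW.
split=> [i _|]; first exact: cat_tree_is_tree.
split=> [i j le_im le_jm /eqP ne_ij /lap_poly_iso E|].
  by case: (ltngtP i j) ne_ij => // lt_ij _; [have := mono i j | have := mono j i];
    rewrite lt_ij ?le_im ?le_jm E ltxx => /(_ isT).
split; first by rewrite T0; apply: cat_tree_star => i lt_i; rewrite /word; lia.
split; first by rewrite Tm; apply: cat_tree_path => i lt_i; rewrite /word; lia.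
by move=> i lt_im; apply/lap_lt_le/Tlt.
Qed.
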